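(* Let $p,q\in\mathbb{N}$ and $\alpha,\beta\in\mathbb{R}$ be such that $q\ge2$ and $|\alpha|\neq|\beta|$. Then the improper integral $$\mathcal{K}_{p,q}(\alpha,\beta)=\int_0^\infty\frac{(\sin\alpha x-\sin\beta x)^p}{x^q}\,dx$$ exists (i.e. converges) if and only if $q\le p$.
   Context: $\mathbb{N}=\{1,2,3,\ldots\}$. The integral is an improper (Riemann) integral at both endpoints: it converges (exists) if $\int_\varepsilon^R$ of the integrand tends to a finite limit as $\varepsilon\to0^+$ and $R\to\infty$ independently, and it diverges otherwise. *)

(* Defs.v *)
From Stdlib Require Import Reals.
From Coquelicot Require Import Coquelicot.
Open Scope R_scope.

Definition K_integrand (p q : nat) (alpha beta x : R) : R :=
  (sin (alpha * x) - sin (beta * x)) ^ p / x ^ q.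

(* [ex_RInt_gen] over [at_right 0] and [Rbar_locally p_infty] asks for a finite
   limit along the product filter, i.e. the two endpoints of the Riemann
   integral on [eps, M] vary independently. *)
Definition K_exists (p q : nat) (alpha beta : R) : Prop :=
  ex_RInt_gen (K_integrand p q alpha beta) (at_right 0) (Rbar_locally p_infty).

(* Main.v *)
Require Import Defs.
From Stdlib Require Import Reals.
From Coquelicot Require Import Coquelicot.
From Stdlib Require Import Lra Lia.
Open Scope R_scope.

(** Only the behaviour at [0] decides. At infinity the integrand is bounded by
    [2 ^ p / x ^ q], which is integrable because [2 <= q]. At [0] the numerator
    [(sin (alpha x) - sin (beta x)) ^ p] behaves like [((alpha - beta) x) ^ p]
    with [alpha <> beta], so the integrand behaves like a nonzero constant times
    [x ^ p / x ^ q].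

    If [q <= p] this stays bounded, and the two regimes merge into one bound by
    a multiple of [1 / (1 + x ^ 2)] ([K_integrand_le]), whose antiderivative
    [atan] has finite limits; [ex_RInt_gen_comparison] concludes.

    If [p < q], then up to a constant factor the integrand is at least [1 / x]
    near [0] ([K_integrand_ge_inv]). Each interval from [a / 2] to [a] then
    carries an integral bounded away from zero, against the Cauchy criterion
    ([not_ex_RInt_gen_ge_inv]).

    Both halves rest on [ex_RInt_gen_Cauchy], which turns convergence along the
    product filter into a separate Cauchy condition at each endpoint. *)

(** * Improper integrals over the positive half-line *)

Lemma ex_RInt_pos (g : R -> R) :
  (forall x, 0 < x -> continuous g x) ->
  forall a b, 0 < a -> 0 < b -> ex_RInt g a b.
Proof.
intros Hg a b Ha Hb.
apply (@ex_RInt_continuous R_CompleteNormedModule); intros z [Hz _].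
apply Hg; apply Rlt_le_trans with (2 := Hz).
now apply Rmin_glb_lt.
Qed.

Lemma RInt_Chasles_pos (g : R -> R) :
  (forall x, 0 < x -> continuous g x) ->
  forall a b c, 0 < a -> 0 < b -> 0 < c ->
  RInt g a b + RInt g b c = RInt g a c.
Proof.
intros Hg a b c Ha Hb Hc.
apply (@RInt_Chasles R_CompleteNormedModule); now apply ex_RInt_pos.
Qed.

(** Since the two endpoints vary independently, comparing two integrals that
    share one endpoint isolates the contribution of a single end; conversely
    the difference of two arbitrary integrals is the sum of one piece near [0]
    and one piece near infinity. *)
Lemma ex_RInt_gen_Cauchy (g : R -> R) :
  (forall x, 0 < x -> continuous g x) ->
  ex_RInt_gen g (at_right 0) (Rbar_locally p_infty) <->
  (forall eps, 0 < eps -> exists d N, 0 < d /\ 0 < N /\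
    (forall a a', 0 < a < d -> 0 < a' < d -> Rabs (RInt g a a') < eps) /\
    (forall b b', N < b -> N < b' -> Rabs (RInt g b b') < eps)).
Proof.
intros Hg; pose proof (RInt_Chasles_pos g Hg) as Ch; split.
- intros [l Hl] eps Heps.
  assert (He : 0 < eps / 2) by lra.
  destruct (Hl _ (locally_ball (l : R_UniformSpace) (mkposreal _ He)))
    as [Q S HQ HS HQS].
  destruct HQ as [d Hd]; destruct HS as [N HN].
  assert (Near : forall a b, 0 < a < d -> Rmax N 1 < b ->
                   Rabs (RInt g a b - l) < eps / 2).
  { intros a b Ha Hb.
    destruct (HQS a b) as [y [Hy By]].
    - apply Hd; [|apply Ha].
      change (Rabs (a - 0) < d); rewrite Rminus_0_r, Rabs_pos_eq; lra.
    - apply HN; apply Rle_lt_trans with (2 := Hb); apply Rmax_l.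
    - rewrite (is_RInt_unique g a b y Hy); exact By. }
  pose proof (cond_pos d) as d_gt0.
  pose proof (Rmax_r N 1) as HM.
  exists d, (Rmax N 1); repeat split; try lra.
  + intros a a' Ha Ha'.
    pose proof (Near a (Rmax N 1 + 1) Ha ltac:(lra)) as H1.
    pose proof (Near a' (Rmax N 1 + 1) Ha' ltac:(lra)) as H2.
    pose proof (Ch a a' (Rmax N 1 + 1) ltac:(lra) ltac:(lra) ltac:(lra)).
    apply Rabs_def2 in H1; apply Rabs_def2 in H2; apply Rabs_def1; lra.
  + intros b b' Hb Hb'.
    pose proof (Near (d / 2) b ltac:(lra) Hb) as H1.
    pose proof (Near (d / 2) b' ltac:(lra) Hb') as H2.
    pose proof (Ch (d / 2) b b' ltac:(lra) ltac:(lra) ltac:(lra)).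
    apply Rabs_def2 in H1; apply Rabs_def2 in H2; apply Rabs_def1; lra.
- intros HC.
  assert (Rect : forall d N, 0 < d ->
    filter_prod (at_right 0) (Rbar_locally p_infty)
      (fun u => 0 < fst u < d /\ N < snd u)).
  { intros d N Hd.
    apply Filter_prod with (fun a => 0 < a < d) (fun b => N < b).
    - exists (mkposreal d Hd); intros a Ba Ha.
      change (Rabs (a - 0) < d) in Ba; apply Rabs_def2 in Ba; lra.
    - now exists N.
    - now intros a b Ha Hb. }
  destruct (proj1 (filterlim_locally_cauchy
    (F := filter_prod (at_right 0) (Rbar_locally p_infty))
    (U := R_CompleteNormedModule) (fun u => RInt g (fst u) (snd u))))
    as [l Hl].
  { intros [eps Heps].
    destruct (HC (eps / 2) ltac:(lra)) as [d [N [Hd [HN [H0 Hoo]]]]].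
    exists (fun u => 0 < fst u < d /\ N < snd u); split; [now apply Rect|].
    intros [a b] [a' b'] [Ha Hb] [Ha' Hb']; simpl in *.
    change (Rabs (RInt g a' b' - RInt g a b) < eps).
    pose proof (H0 a' a Ha' Ha) as H1.
    pose proof (Hoo b b' Hb Hb') as H2.
    pose proof (Ch a' a b ltac:(lra) ltac:(lra) ltac:(lra)).
    pose proof (Ch a' b b' ltac:(lra) ltac:(lra) ltac:(lra)).
    apply Rabs_def2 in H1; apply Rabs_def2 in H2; apply Rabs_def1; lra. }
  exists l; intros P HP.
  specialize (Hl P HP); unfold filtermap in Hl; unfold filtermapi.
  generalize (filter_and _ _ Hl (Rect 1 0 Rlt_0_1)).
  apply filter_imp; intros [a b] [HPab [Ha Hb]]; simpl in *.
  exists (RInt g a b); split; [|exact HPab].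
  apply (@RInt_correct R_CompleteNormedModule); apply ex_RInt_pos; lra || auto.
Qed.

(** The absolute value on the right makes the bound independent of the order of
    the endpoints, as the Cauchy condition requires. *)
Lemma Rabs_RInt_le (g h : R -> R) :
  (forall x, 0 < x -> continuous g x) ->
  (forall x, 0 < x -> continuous h x) ->
  (forall x, 0 < x -> Rabs (g x) <= h x) ->
  forall a b, 0 < a -> 0 < b -> Rabs (RInt g a b) <= Rabs (RInt h a b).
Proof.
intros Hg Hh Hgh.
assert (Ord : forall a b, 0 < a -> a <= b ->
          Rabs (RInt g a b) <= Rabs (RInt h a b)).
{ intros a b Ha Hab; apply Rle_trans with (2 := Rle_abs _).
  apply (@norm_RInt_le R_NormedModule g h a b); try easy.
  - intros x Hx; apply Hgh; lra.
  - apply (@RInt_correct R_CompleteNormedModule); apply ex_RInt_pos; lra || auto.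
  - apply (@RInt_correct R_CompleteNormedModule); apply ex_RInt_pos; lra || auto. }
intros a b Ha Hb; destruct (Rle_dec a b) as [Hab|Hab]; [now apply Ord|].
rewrite <- (opp_RInt_swap g b a), <- (opp_RInt_swap h b a)
  by (apply ex_RInt_pos; auto).
change (Rabs (- RInt g b a) <= Rabs (- RInt h b a)).
rewrite !Rabs_Ropp; apply Ord; lra.
Qed.

Lemma ex_RInt_gen_comparison (g h : R -> R) :
  (forall x, 0 < x -> continuous g x) ->
  (forall x, 0 < x -> continuous h x) ->
  (forall x, 0 < x -> Rabs (g x) <= h x) ->
  ex_RInt_gen h (at_right 0) (Rbar_locally p_infty) ->
  ex_RInt_gen g (at_right 0) (Rbar_locally p_infty).
Proof.
intros Hg Hh Hgh Ih.
apply (ex_RInt_gen_Cauchy g Hg); intros eps Heps.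
destruct (proj1 (ex_RInt_gen_Cauchy h Hh) Ih eps Heps)
  as [d [N [Hd [HN [H0 Hoo]]]]].
exists d, N; repeat split; auto.
- intros a a' Ha Ha'; apply Rle_lt_trans with (2 := H0 a a' Ha Ha').
  apply Rabs_RInt_le; tauto.
- intros b b' Hb Hb'; apply Rle_lt_trans with (2 := Hoo b b' Hb Hb').
  apply Rabs_RInt_le; lra || auto.
Qed.

(** The antiderivative [M * atan] has limits at both ends; at infinity this is
    read off at [0] through [atan x = PI / 2 - atan (/ x)]. *)
Lemma ex_RInt_gen_inv_1_plus_sqr (M : R) :
  ex_RInt_gen (fun x => M / (1 + x ^ 2)) (at_right 0) (Rbar_locally p_infty).
Proof.
assert (Hc : forall x, continuous (fun x => M / (1 + x ^ 2)) x).
{ intros x; apply (@ex_derive_continuous R_AbsRing R_NormedModule).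
  auto_derive; nra. }
assert (HI : forall a b,
          RInt (fun x => M / (1 + x ^ 2)) a b = M * atan b - M * atan a).
{ intros a b; apply is_RInt_unique.
  apply (is_RInt_derive (fun x => M * atan x)); intros x _; [|apply Hc].
  auto_derive; [easy|unfold Rsqr; field; nra]. }
apply ex_RInt_gen_Cauchy; [auto|]; intros eps Heps.
assert (Hlim : continuous (fun x => M * atan x) 0).
{ apply (@ex_derive_continuous R_AbsRing R_NormedModule); auto_derive; easy. }
assert (He : 0 < eps / 2) by lra.
destruct (Hlim _ (locally_ball _ (mkposreal _ He))) as [[d Hd] Hball].
assert (Small : forall x, 0 < x < d -> Rabs (M * atan x) < eps / 2).
{ intros x Hx.
  assert (Bx : ball 0 d x).
  { change (Rabs (x - 0) < d); rewrite Rminus_0_r, Rabs_pos_eq; lra. }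
  generalize (Hball x Bx).
  change (Rabs (M * atan x - M * atan 0) < eps / 2 ->
          Rabs (M * atan x) < eps / 2).
  now rewrite atan_0, Rmult_0_r, Rminus_0_r. }
exists d, (/ d); repeat split.
- exact Hd.
- now apply Rinv_0_lt_compat.
- intros a a' Ha Ha'; rewrite HI.
  pose proof (Small a Ha) as H1; pose proof (Small a' Ha') as H2.
  apply Rabs_def2 in H1; apply Rabs_def2 in H2; apply Rabs_def1; lra.
- assert (Far : forall b, / d < b -> 0 < b /\ 0 < / b < d).
  { intros b Hb.
    pose proof (Rinv_0_lt_compat d Hd).
    assert (0 < b) by lra; repeat split; auto.
    - now apply Rinv_0_lt_compat.
    - rewrite <- (Rinv_inv d); apply Rinv_lt_contravar; [nra|lra]. }
  intros b b' Hb Hb'; rewrite HI.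
  destruct (Far b Hb) as [Pb Sb]; destruct (Far b' Hb') as [Pb' Sb'].
  pose proof (Small _ Sb) as H1; pose proof (Small _ Sb') as H2.
  rewrite (atan_inv b Pb) in H1; rewrite (atan_inv b' Pb') in H2.
  apply Rabs_def2 in H1; apply Rabs_def2 in H2; apply Rabs_def1; lra.
Qed.

(** The integrals over the intervals from [a / 2] to [a] do not become small as
    [a] tends to [0]: there [c * g] is at least [k / a] on a length [a / 2], so
    each contributes at least [k / 2]. The factor [c] lets [g] have either
    sign. *)
Lemma not_ex_RInt_gen_ge_inv (g : R -> R) (c k d : R) :
  (forall x, 0 < x -> continuous g x) ->
  0 < k -> 0 < d ->
  (forall x, 0 < x < d -> k / x <= c * g x) ->
  ~ ex_RInt_gen g (at_right 0) (Rbar_locally p_infty).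
Proof.
intros Hg Hk Hd Hge Ig.
(* The [+ 1] keeps the divisor positive without assuming [c <> 0]. *)
assert (He : 0 < k / 2 / (Rabs c + 1)).
{ pose proof (Rabs_pos c); apply Rdiv_lt_0_compat; lra. }
destruct (proj1 (ex_RInt_gen_Cauchy g Hg) Ig _ He)
  as [d' [N [Hd' [_ [H0 _]]]]].
pose (a := Rmin d d' / 2).
assert (Ha : 0 < a /\ a < d /\ a < d').
{ pose proof (Rmin_l d d'); pose proof (Rmin_r d d').
  pose proof (Rmin_glb_lt d d' 0 Hd Hd'); unfold a; lra. }
assert (Iint : ex_RInt g (a / 2) a) by (apply ex_RInt_pos; lra || auto).
pose proof (H0 (a / 2) a ltac:(lra) ltac:(lra)) as Hsmall.
assert (Hbig : k / 2 <= c * RInt g (a / 2) a).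
{ replace (k / 2) with (RInt (fun _ => k / a) (a / 2) a).
  2: { rewrite RInt_const; change ((a - a / 2) * (k / a) = k / 2); field; lra. }
  change (c * RInt g (a / 2) a) with (scal c (RInt g (a / 2) a)).
  rewrite <- RInt_scal by assumption.
  apply RInt_le.
  - lra.
  - apply ex_RInt_const.
  - now apply (@ex_RInt_scal R_NormedModule).
  - intros x Hx; apply Rle_trans with (k / x).
    + apply Rmult_le_compat_l; [lra|]; apply Rinv_le_contravar; lra.
    + apply Hge; lra. }
pose proof (Rle_abs (c * RInt g (a / 2) a)) as Habs.
rewrite Rabs_mult in Habs.
apply (Rmult_lt_compat_r (Rabs c + 1)) in Hsmall;
  [|pose proof (Rabs_pos c); lra].
replace (k / 2 / (Rabs c + 1) * (Rabs c + 1)) with (k / 2) in Hsmall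
  by (field; pose proof (Rabs_pos c); lra).
pose proof (Rabs_pos (RInt g (a / 2) a)); lra.
Qed.

(** * The integrand *)

Lemma continuous_K_integrand (p q : nat) (alpha beta x : R) :
  0 < x -> continuous (K_integrand p q alpha beta) x.
Proof.
intros Hx; apply (@ex_derive_continuous R_AbsRing R_NormedModule).
unfold K_integrand; auto_derive.
pose proof (pow_lt x q Hx); lra.
Qed.

(** The bound [sin y < y] for positive [y] controls only one side; the other is
    trivial up to [PI], where the sine is nonnegative, and beyond [PI], where
    [y] exceeds [1]. *)
Lemma Rabs_sin_le (y : R) : Rabs (sin y) <= Rabs y.
Proof.
assert (Pos : forall y, 0 < y -> Rabs (sin y) <= y).
{ clear y; intros y Hy; pose proof (sin_lt_x y Hy).
  pose proof (SIN_bound y); pose proof PI2_3_2.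
  destruct (Rle_dec y PI) as [Hpi|Hpi].
  - pose proof (sin_ge_0 y ltac:(lra) Hpi); apply Rabs_le; lra.
  - apply Rabs_le; lra. }
destruct (Rtotal_order y 0) as [Hy|[Hy|Hy]].
- rewrite <- (Rabs_Ropp (sin y)), <- sin_neg, <- (Rabs_Ropp y).
  rewrite (Rabs_pos_eq (- y)) by lra; apply Pos; lra.
- subst y; rewrite sin_0; lra.
- rewrite (Rabs_pos_eq y) by lra; now apply Pos.
Qed.

(** Near [0] the numerator is at most [(L * x) ^ p] with
    [L = |alpha| + |beta|], and [q <= p] absorbs the denominator; beyond [1] it
    is at most [2 ^ p], and [2 <= q] gives decay. *)
Lemma K_integrand_le (p q : nat) (alpha beta x : R) :
  (2 <= q)%nat -> (q <= p)%nat -> 0 < x ->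
  Rabs (K_integrand p q alpha beta x) <=
    2 * ((Rabs alpha + Rabs beta) ^ p + 2 ^ p) / (1 + x ^ 2).
Proof.
intros Hq Hqp Hx.
set (L := Rabs alpha + Rabs beta).
assert (HL : 0 <= L ^ p).
{ apply pow_le; unfold L; pose proof (Rabs_pos alpha);
  pose proof (Rabs_pos beta); lra. }
pose proof (pow_lt 2 p ltac:(lra)) as H2.
pose proof (pow_lt x q Hx) as Hxq.
unfold K_integrand; rewrite Rabs_div by lra.
rewrite (Rabs_pos_eq (x ^ q)) by lra; rewrite <- RPow_abs.
set (s := Rabs (sin (alpha * x) - sin (beta * x))).
assert (Hs : 0 <= s) by apply Rabs_pos.
apply Rmult_le_reg_r with (x ^ q * (1 + x ^ 2)); [apply Rmult_lt_0_compat; nra|].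
replace (s ^ p / x ^ q * (x ^ q * (1 + x ^ 2))) with (s ^ p * (1 + x ^ 2))
  by (field; lra).
replace (2 * (L ^ p + 2 ^ p) / (1 + x ^ 2) * (x ^ q * (1 + x ^ 2)))
  with (2 * (L ^ p + 2 ^ p) * x ^ q) by (field; nra).
destruct (Rle_dec x 1) as [H1|H1].
- assert (Hsx : s <= L * x).
  { pose proof (Rabs_sin_le (alpha * x)) as Ha.
    pose proof (Rabs_sin_le (beta * x)) as Hb.
    rewrite Rabs_mult, (Rabs_pos_eq x) in Ha, Hb by lra.
    unfold s, Rminus; eapply Rle_trans; [apply Rabs_triang|].
    rewrite Rabs_Ropp; unfold L; lra. }
  pose proof (pow_incr s (L * x) p (conj Hs Hsx)) as Hsp.
  rewrite Rpow_mult_distr in Hsp.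
  assert (Hxpq : x ^ p <= x ^ q).
  { replace p with ((p - q) + q)%nat by lia; rewrite pow_add.
    pose proof (pow_incr x 1 (p - q) ltac:(lra)) as Hle; rewrite pow1 in Hle.
    nra. }
  assert (s ^ p <= L ^ p * x ^ q) by nra.
  pose proof (pow_le s p Hs).
  assert (1 + x ^ 2 <= 2) by nra.
  apply Rle_trans with (L ^ p * x ^ q * 2); [|nra].
  apply Rmult_le_compat; nra.
- assert (Hs2 : s <= 2).
  { pose proof (SIN_bound (alpha * x)); pose proof (SIN_bound (beta * x)).
    apply Rabs_le; lra. }
  pose proof (pow_incr s 2 p (conj Hs Hs2)).
  pose proof (Rle_pow x 2 q ltac:(lra) Hq).
  pose proof (pow_le s p Hs).
  apply Rle_trans with (2 ^ p * (2 * x ^ q)); [|nra].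
  apply Rmult_le_compat; nra.
Qed.

(** The quotient [(sin (alpha x) - sin (beta x)) / x] tends to
    [alpha - beta <> 0], so its [p]-th power has a fixed sign and is bounded
    away from [0]; the surplus power [x ^ (q - p)] in the denominator is at
    most [x]. Multiplying by [c = (alpha - beta) ^ p] makes the sign
    positive. *)
Lemma K_integrand_ge_inv (p q : nat) (alpha beta : R) :
  (p < q)%nat -> alpha <> beta ->
  exists d, 0 < d /\ forall x, 0 < x < d ->
    ((alpha - beta) ^ p) ^ 2 / 2 / x
      <= (alpha - beta) ^ p * K_integrand p q alpha beta x.
Proof.
intros Hpq Hab.
set (c := (alpha - beta) ^ p).
assert (Hc : c <> 0) by (apply pow_nonzero; lra).
assert (Hder : derivable_pt_lim
                 (fun x => sin (alpha * x) - sin (beta * x)) 0 (alpha - beta)).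
{ apply is_derive_Reals; auto_derive; [easy|].
  rewrite !Rmult_0_r, cos_0; ring. }
assert (Hpow : continuous (fun y => y ^ p) (alpha - beta)).
{ apply (@ex_derive_continuous R_AbsRing R_NormedModule); auto_derive; easy. }
assert (He : 0 < Rabs c / 2) by (pose proof (Rabs_pos_lt c Hc); lra).
destruct (Hpow _ (locally_ball _ (mkposreal _ He))) as [[e Hepos] Hball].
destruct (Hder e Hepos) as [[d Hd] Hquot].
exists (Rmin d 1); split; [apply Rmin_glb_lt; lra|].
intros x Hx; pose proof (Rmin_l d 1); pose proof (Rmin_r d 1).
set (r := (sin (alpha * x) - sin (beta * x)) / x).
assert (Hr : Rabs (r ^ p - c) < Rabs c / 2).
{ apply Hball.
  assert (Hxd : Rabs x < d) by (rewrite Rabs_pos_eq; lra).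
  generalize (Hquot x ltac:(lra) Hxd).
  now rewrite Rplus_0_l, !Rmult_0_r, sin_0, !Rminus_0_r. }
assert (Hcr : c ^ 2 / 2 <= c * r ^ p).
{ assert (Hm : Rabs (c * (r ^ p - c)) <= c ^ 2 / 2).
  { rewrite Rabs_mult; pose proof (Rabs_pos c).
    replace (c ^ 2) with (Rabs c * Rabs c)
      by (rewrite <- Rabs_mult, Rabs_pos_eq; nra).
    nra. }
  apply Rabs_le_between in Hm; nra. }
assert (Hinv : / x <= / x ^ (q - p)).
{ apply Rinv_le_contravar; [apply pow_lt; lra|].
  replace (q - p)%nat with (S (q - p - 1)) by lia; simpl.
  pose proof (pow_incr x 1 (q - p - 1) ltac:(lra)) as Hle.
  rewrite pow1 in Hle; nra. }
assert (HK : K_integrand p q alpha beta x = r ^ p * / x ^ (q - p)).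
{ unfold K_integrand, r, Rdiv; rewrite Rpow_mult_distr, pow_inv.
  replace (x ^ q) with (x ^ p * x ^ (q - p))
    by (rewrite <- pow_add; f_equal; lia).
  rewrite Rinv_mult; ring. }
rewrite HK, <- Rmult_assoc; unfold Rdiv at 1.
pose proof (Rinv_0_lt_compat x ltac:(lra)).
apply Rmult_le_compat; nra.
Qed.

Theorem theorem6p4 (p q : nat) (alpha beta : R)
  (hp : (1 <= p)%nat) (hq : (2 <= q)%nat)
  (hab : Rabs alpha <> Rabs beta) :
  K_exists p q alpha beta <-> (q <= p)%nat.
Proof.
unfold K_exists; split.
- intros HK; destruct (Nat.le_gt_cases q p) as [Hqp|Hpq]; [exact Hqp|exfalso].
  assert (Hab : alpha <> beta) by congruence.
  destruct (K_integrand_ge_inv p q alpha beta Hpq Hab) as [d [Hd Hge]].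
  revert HK; apply not_ex_RInt_gen_ge_inv with (4 := Hge); auto.
  + intros x; apply continuous_K_integrand.
  + assert ((alpha - beta) ^ p <> 0) by (apply pow_nonzero; lra); nra.
- intros Hqp.
  apply ex_RInt_gen_comparison with
    (fun x => 2 * ((Rabs alpha + Rabs beta) ^ p + 2 ^ p) / (1 + x ^ 2)).
  + intros x; apply continuous_K_integrand.
  + intros x _; apply (@ex_derive_continuous R_AbsRing R_NormedModule).
    auto_derive; nra.
  + intros x; now apply K_integrand_le.
  + apply ex_RInt_gen_inv_1_plus_sqr.
Qed.
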